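(* Let $\alpha,\beta>-1$, $N\ge1$, and let $\mathcal S=\{s_1,\ldots,s_N\}$ be an $\omega_{\alpha,\beta}$-admissible family of nondegenerate intervals in $[-1,1]$. Let $H_N^{(\alpha,\beta)}$ be the matrix of the linear map \[ \mathcal J_{\mathcal S}^{(\alpha,\beta)}:\Pi_N\to\mathbb R^{N+1},\qquad p\mapsto\left[\mathcal M_{\alpha,\beta}(p),\mathcal D_1^{\omega_{\alpha,\beta}}(p),\ldots,\mathcal D_N^{\omega_{\alpha,\beta}}(p)\right]^\top \] with respect to the Jacobi basis $\{P_0^{(\alpha,\beta)},\ldots,P_N^{(\alpha,\beta)}\}$ of $\Pi_N$ and the canonical basis of $\mathbb R^{N+1}$. Then \[ H_N^{(\alpha,\beta)}=\begin{bmatrix} h_0^{(\alpha,\beta)} & \boldsymbol 0^\top\\ \boldsymbol 0 & D_N^{(\alpha,\beta)}\end{bmatrix},\qquad h_0^{(\alpha,\beta)}=\mathcal M_{\alpha,\beta}(1)=\int_{-1}^1\omega_{\alpha,\beta}(x)\,dx . \] In particular, $H_N^{(\alpha,\beta)}$ and $D_N^{(\alpha,\beta)}$ are nonsingular.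
   Context: $\Pi_n$ is the space of real univariate polynomials of degree at most $n$. $\omega_{\alpha,\beta}(x)=(1-x)^\alpha(1+x)^\beta$ on $(-1,1)$. $P_k^{(\alpha,\beta)}$ is the Jacobi polynomial of degree $k$ in the standard normalization (so $P_0^{(\alpha,\beta)}=1$), orthogonal on $[-1,1]$ with respect to $\omega_{\alpha,\beta}$. For a weight $\omega$, $\mathcal D_i^{\omega}(f)=\int_{s_i}f'(x)\omega(x)\,dx$. The normalization functional is $\mathcal M_{\alpha,\beta}(f)=\int_{-1}^1f(x)\omega_{\alpha,\beta}(x)\,dx$. The reduced derivative matrix $D_N^{(\alpha,\beta)}\in\mathbb R^{N\times N}$ has entries $[D_N^{(\alpha,\beta)}]_{ik}=\int_{s_i}\frac{d}{dx}P_k^{(\alpha,\beta)}(x)\,\omega_{\alpha,\beta}(x)\,dx$, $i,k=1,\ldots,N$. A family $\mathcal S=\{s_1,\ldots,s_N\}$ of intervals $s_i=[a_i,b_i]\subset[-1,1]$, $a_i<b_i$, is $\omega$-admissible if the linear map $\Pi_{N-1}\to\mathbb R^N$, $q\mapsto[\int_{s_i}q\,\omega\,dx]_{i=1}^N$, is an isomorphism. *)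

(* Defs.v *)
From HB Require Import structures.
From mathcomp Require Import all_boot all_order all_algebra.
From mathcomp Require Import all_classical all_reals all_analysis.
From mathcomp Require Import measurable_realfun lra.

Set Implicit Arguments.
Unset Strict Implicit.
Unset Printing Implicit Defensive.

Import Order.TTheory GRing.Theory Num.Theory.
Import numFieldNormedType.Exports.

Local Open Scope classical_set_scope.
Local Open Scope ring_scope.

(* Only the values on `]-1, 1[ matter: every integral below is a Lebesgue
   integral over a subinterval of `[-1, 1], and the endpoints, where powR takes
   a conventional finite value, form a null set. *)
Definition jacobi_weight {R : realType} (alpha beta x : R) : R :=
  (1 - x) `^ alpha * (1 + x) `^ beta.

Definition rising {R : realType} (x : R) (n : nat) : R :=
  \prod_(i < n) (x + i%:R).

(* The hypergeometric form
     P_n(x) = (alpha + 1)_n / n!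
              * 2F1(-n, n + alpha + beta + 1; alpha + 1; (1 - x) / 2)
   of the Jacobi polynomial, with (alpha + 1)_n / (alpha + 1)_l simplified to
   (alpha + l + 1)_(n - l) and (-n)_l = (-1)^l n! / (n - l)!; it is normalized
   by P_n(1) = (alpha + 1)_n / n!. *)
Definition jacobi {R : realType} (alpha beta : R) (n : nat) : {poly R} :=
  \sum_(l < n.+1)
    (rising (n%:R + alpha + beta + 1) l
       * rising (alpha + l%:R + 1) (n - l) / (l`! * (n - l)`!)%:R)
    *: (2^-1 *: ('X - 1)) ^+ l.

Definition normalization_functional {R : realType} (w f : R -> R) : R :=
  \int[@lebesgue_measure R]_(x in `[-1, 1]) (f x * w x).

Definition deriv_functional {R : realType} (w : R -> R) (a b : R)
    (f : R -> R) : R :=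
  \int[@lebesgue_measure R]_(x in `[a, b]) (f^`()%classic x * w x).

(* Pi_n is {poly_n.+1 R}, since {poly_m R} bounds the size, not the degree.
   The intervals s_i = [a i, b i] are indexed by 'I_N, i.e. from 0. *)
Definition moment_map {R : realType} (w : R -> R) (N : nat) (a b : 'I_N -> R)
    (q : {poly_N R}) : 'cV[R]_N :=
  \col_i \int[@lebesgue_measure R]_(x in `[a i, b i]) (q.[x] * w x).

Definition admissible {R : realType} (w : R -> R) (N : nat) (a b : 'I_N -> R) :=
  bijective (moment_map w a b).

Definition reduced_deriv_matrix {R : realType} (alpha beta : R) (N : nat)
    (a b : 'I_N -> R) : 'M[R]_N :=
  \matrix_(i, k) deriv_functional (jacobi_weight alpha beta) (a i) (b i)
                   (horner (jacobi alpha beta k.+1)).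

Definition data_map {R : realType} (alpha beta : R) (N : nat)
    (a b : 'I_N -> R) (p : {poly_(1 + N) R}) : 'cV[R]_(1 + N) :=
  let w := jacobi_weight alpha beta in
  col_mx (normalization_functional w (horner p))%:M
         (\col_i deriv_functional w (a i) (b i) (horner p)).

Lemma size_jacobi_le {R : realType} (alpha beta : R) (n : nat) :
  (size (jacobi alpha beta n) <= n.+1)%N.
Proof.
apply: (leq_trans (size_sum _ _ _)); apply/bigmax_leqP => l _.
apply: (leq_trans (size_scale_leq _ _)).
apply: (leq_trans (size_exp_leq _ _)); rewrite ltnS.
apply: leq_trans (ltn_ord l : (l <= n)%N).
rewrite -[leqRHS]mul1n leq_mul2r; apply/orP; right.
by rewrite -subn1 leq_subLR (leq_trans (size_scale_leq _ _))// -polyC1 size_XsubC.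
Qed.

Lemma jacobi_in_Pi {R : realType} (alpha beta : R) (N : nat) (k : 'I_N.+1) :
  jacobi alpha beta k \is a poly_of_size N.+1.
Proof. exact: leq_trans (size_jacobi_le _ _ _) (ltn_ord k). Qed.

Definition jacobi_basis {R : realType} (alpha beta : R) (N : nat) :
    (1 + N).-tuple {poly_(1 + N) R} :=
  [tuple NPoly (jacobi_in_Pi alpha beta k) | k < 1 + N].

(* Matrix, acting on columns, with respect to the canonical basis of the
   codomain: its k-th column is f X_k. *)
Definition matrix_of {R : realType} (V : lmodType R) (m n : nat)
    (X : n.-tuple V) (f : V -> 'cV[R]_m) : 'M[R]_(m, n) :=
  \matrix_(i, k) f (tnth X k) i 0.

Definition data_matrix {R : realType} (alpha beta : R) (N : nat)
    (a b : 'I_N -> R) : 'M[R]_(1 + N) :=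
  matrix_of (jacobi_basis alpha beta N) (data_map alpha beta a b).

(* The maps and the basis above are what their names claim: moment_map and
   data_map are linear on the Jacobi weight, all integrals being finite, and
   the Jacobi polynomials form a basis. *)
Section integrability.
Context {R : realType}.
Notation mu := (@lebesgue_measure R).

Lemma integrable_bounded_primitive (f F : R -> R) (c d M : R) : c < d ->
  measurable_fun `]c, d[ f -> (forall x, x \in `]c, d[ -> 0 <= f x) ->
  {in `]c, d[, continuous f} ->
  (forall x, x \in `]c, d[ -> is_derive x 1 F (f x)) ->
  (forall x, x \in `]c, d[ -> `|F x| <= M) ->
  mu.-integrable `]c, d[ (EFin \o f).
Proof.
move=> cd mf f0 cf dF FM.
pose e (n : nat) : R := (d - c) / n.+3%:R.
have e0 n : 0 < e n by rewrite divr_gt0 ?subr_gt0 ?ltr0n.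
have e2 n : e n * 2 < d - c.
  rewrite /e -mulrA gtr_pMr ?subr_gt0// mulrC ltr_pdivrMr ?ltr0n// mul1r.
  by rewrite ltr_nat.
have e_le m n : (m <= n)%N -> e n <= e m.
  by move=> mn; rewrite ler_pM2l ?subr_gt0// lef_pV2 ?posrE ?ltr0n// ler_nat.
pose E (n : nat) : set R := `[c + e n, d - e n]%classic.
have subE n x : E n x -> x \in `]c, d[.
  by rewrite /E/= !in_itv/= => /andP[h1 h2]; have := e0 n; lra.
have bigE : `]c, d[%classic = \bigcup_n E n.
  apply/seteqP; split => [x /=|x [n _] /subE//].
  rewrite in_itv/= => /andP[cx xd].
  have m0 : 0 < Order.min (x - c) (d - x) by rewrite lt_min !subr_gt0 cx xd.
  pose n := Num.truncn ((d - c) / Order.min (x - c) (d - x)).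
  exists n => //.
  have : e n <= Order.min (x - c) (d - x).
    rewrite /e ler_pdivrMr ?ltr0n// mulrC -ler_pdivrMr//.
    apply/ltW/(lt_le_trans (truncnS_gt _)).
    by rewrite ler_nat /n ltnS ltnW// ltnW.
  rewrite le_min => /andP[h1 h2]; rewrite /E/= in_itv/=; lra.
have mEf n : measurable_fun (E n) f.
  apply: measurable_funS mf => //.
  by move=> x /subE.
have cvgE : (\int[mu]_(x in E n) (f x)%:E @[n --> \oo] -->
    \int[mu]_(x in `]c, d[) (f x)%:E)%E.
  rewrite bigE; apply: ge0_nondecreasing_set_cvg_integral => //.
  - move=> m n mn; apply/subsetPset => x; rewrite /E/= !in_itv/= => /andP[h1 h2].
    by have := e_le _ _ mn; lra.
  - by move=> n; exact: measurable_itv.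
  - by move=> n; exact: (proj2 (measurable_EFinP _ _) (mEf n)).
  - by move=> n x /subE/f0; rewrite lee_fin.
apply/integrableP; split; first exact/measurable_EFinP.
under eq_integral => x xcd.
  rewrite /= ger0_norm; last by apply: f0; rewrite inE in xcd.
  over.
apply: (@le_lt_trans _ _ (M *+ 2)%:E); last exact: ltry.
apply: (cvge_le _ cvgE); apply: nearW => n.
have cFx x : x \in `]c, d[ -> {for x, continuous F}.
  move=> /dF dFx; apply/differentiable_continuous/derivable1_diffP.
  exact: ex_derive.
have ab : c + e n < d - e n by have := e2 n; lra.
have inn x : x \in `[c + e n, d - e n] -> x \in `]c, d[ by exact: subE.
rewrite (@continuous_FTC2 _ f F)//.
- rewrite -EFinB lee_fin mulr2n.
  rewrite (le_trans (ler_norm _))// (le_trans (ler_normB _ _))//.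
  by rewrite lerD// FM// inn// bound_itvE ltW.
- by apply: continuous_in_subspaceT => x; rewrite inE/= => /inn/cf.
- split.
  + by move=> x /subset_itv_oo_cc/inn/dF dFx; exact: ex_derive.
  + by apply/cvg_at_right_filter/cFx/inn; rewrite bound_itvE ltW.
  + by apply/cvg_at_left_filter/cFx/inn; rewrite bound_itvE ltW.
- by move=> x /subset_itv_oo_cc/inn/dF dFx; rewrite derive1E derive_val.
Qed.

Lemma measurable_fun_powR (D : set R) (f : R -> R) (p : R) :
  measurable_fun D f -> measurable_fun D (fun x => f x `^ p).
Proof. exact: (@measurableT_comp _ _ _ _ _ _ (@powR R ^~ p)). Qed.

Lemma continuous_powR_pos (p x : R) : 0 < x -> {for x, continuous (@powR R ^~ p)}.
Proof.
move=> x0; apply/differentiable_continuous/derivable1_diffP.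
by apply: derivable_powR; rewrite in_itv/= x0.
Qed.

Lemma integrable_powR_right (p : R) : -1 < p ->
  mu.-integrable `]-1, 1[ (EFin \o (fun x => (1 + x) `^ p)).
Proof.
move=> p1; have p0 : 0 < p + 1 by lra.
apply: (@integrable_bounded_primitive _
  (fun x => (p + 1)^-1 * (1 + x) `^ (p + 1)) _ _
  ((p + 1)^-1 * 2 `^ (p + 1))); first lra.
- by apply: measurable_fun_powR; exact: measurable_funD.
- by move=> x _; exact: powR_ge0.
- move=> x; rewrite in_itv/= => xx.
  have c1 : {for x, continuous (fun y : R => 1 + y)}.
    by apply: cvgD; [exact: cvg_cst|exact: cvg_id].
  by apply: (continuous_comp c1 (continuous_powR_pos (p := p) _)); lra.
- move=> x; rewrite in_itv/= => xx.
  have x0 : 0 < 1 + x by lra.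
  have d1 : is_derive x 1 (fun x : R => 1 + x) 1.
    by rewrite -[X in is_derive _ _ _ X]add0r; apply: is_deriveD.
  have d2 := @is_derive1_comp _ (@powR R ^~ (p + 1)) (fun x : R => 1 + x) x _ _
    (is_derive1_powR (p + 1) x0) d1.
  have d3 := @is_deriveZ _ _ _ _ (p + 1)^-1 _ _ _ d2.
  apply: (is_derive_eq d3).
  by rewrite addrK mulr1 /GRing.scale/= mulrA mulVf ?gt_eqF// mul1r.
- move=> x; rewrite in_itv/= => xx.
  rewrite ger0_norm ?mulr_ge0 ?invr_ge0 ?powR_ge0 ?(ltW p0)//.
  rewrite ler_pM2l ?invr_gt0//.
  by apply: ge0_ler_powR; rewrite ?nnegrE; lra.
Qed.

Lemma integrable_powR_left (p : R) : -1 < p ->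
  mu.-integrable `]-1, 1[ (EFin \o (fun x => (1 - x) `^ p)).
Proof.
move=> p1; have p0 : 0 < p + 1 by lra.
apply: (@integrable_bounded_primitive _
  (fun x => - (p + 1)^-1 * (1 - x) `^ (p + 1)) _ _
  ((p + 1)^-1 * 2 `^ (p + 1))); first lra.
- by apply: measurable_fun_powR; exact: measurable_funB.
- by move=> x _; exact: powR_ge0.
- move=> x; rewrite in_itv/= => xx.
  have c1 : {for x, continuous (fun y : R => 1 - y)}.
    by apply: cvgB; [exact: cvg_cst|exact: cvg_id].
  by apply: (continuous_comp c1 (continuous_powR_pos (p := p) _)); lra.
- move=> x; rewrite in_itv/= => xx.
  have x0 : 0 < 1 - x by lra.
  have d1 : is_derive x 1 (fun x : R => 1 - x) (-1).
    by rewrite -[X in is_derive _ _ _ X]add0r; apply: is_deriveB.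
  have d2 := @is_derive1_comp _ (@powR R ^~ (p + 1)) (fun x : R => 1 - x) x _ _
    (is_derive1_powR (p + 1) x0) d1.
  have d3 := @is_deriveZ _ _ _ _ (- (p + 1)^-1) _ _ _ d2.
  apply: (is_derive_eq d3).
  by rewrite addrK mulrN1 /GRing.scale/= mulrNN mulrA mulVf ?gt_eqF// mul1r.
- move=> x; rewrite in_itv/= => xx.
  rewrite normrM normrN !ger0_norm ?invr_ge0 ?powR_ge0 ?(ltW p0)//.
  rewrite ler_pM2l ?invr_gt0//.
  by apply: ge0_ler_powR; rewrite ?nnegrE; lra.
Qed.

Lemma measurable_jacobi_weight (alpha beta : R) :
  measurable_fun [set: R] (jacobi_weight alpha beta).
Proof.
apply: measurable_funM; apply: measurable_fun_powR.
- exact: measurable_funB.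
- exact: measurable_funD.
Qed.

Lemma integrable_jacobi_weight (alpha beta : R) : -1 < alpha -> -1 < beta ->
  mu.-integrable `[-1, 1] (EFin \o jacobi_weight alpha beta).
Proof.
move=> ha hb.
suff : mu.-integrable `]-1, 1[ (EFin \o jacobi_weight alpha beta).
  move/integrableP => [_ fin]; apply/integrableP; split.
    apply/measurable_EFinP/measurable_funTS; exact: measurable_jacobi_weight.
  rewrite (integral_itv_bndoo true false)//.
  apply: measurableT_comp => //.
  by apply/measurable_EFinP/measurable_funTS; exact: measurable_jacobi_weight.
have bd (y p : R) : 1 <= y <= 2 -> y `^ p <= 2 `^ `|p|.
  move=> /andP[y1 y2]; apply: (@le_trans _ _ (y `^ `|p|)).
    by apply: ler_powR => //; exact: ler_norm.
  by apply: ge0_ler_powR; rewrite ?nnegrE ?normr_ge0//; lra.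
apply: (@le_integrable _ _ _ mu `]-1, 1[ (measurable_itv _) _
  (fun x => (2 `^ `|beta|)%:E * ((1 - x) `^ alpha)%:E
          + (2 `^ `|alpha|)%:E * ((1 + x) `^ beta)%:E)%E).
- apply/measurable_EFinP/measurable_funTS; exact: measurable_jacobi_weight.
- move=> x /=; rewrite in_itv/= => xx; rewrite lee_fin.
  have A0 := powR_ge0 (1 - x) alpha; have B0 := powR_ge0 (1 + x) beta.
  rewrite [leLHS]ger0_norm ?mulr_ge0// [leRHS]ger0_norm; last first.
    by rewrite addr_ge0 ?mulr_ge0 ?powR_ge0.
  rewrite /jacobi_weight.
  have [x0|x0] := leP 0 x.
    rewrite -[leLHS]addr0 lerD ?mulr_ge0 ?powR_ge0// mulrC ler_wpM2r//.
    by apply: bd; lra.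
  rewrite -[leLHS]add0r lerD ?mulr_ge0 ?powR_ge0// ler_wpM2r//.
  by apply: bd; lra.
- apply: integrableD => //=; apply: integrableZl => //.
  + exact: integrable_powR_left.
  + exact: integrable_powR_right.
Qed.

Lemma integrable_horner_weight (alpha beta : R) (p : {poly R}) (a b : R) :
  -1 < alpha -> -1 < beta -> -1 <= a -> b <= 1 ->
  mu.-integrable `[a, b]
    (EFin \o (fun x => p.[x] * jacobi_weight alpha beta x)).
Proof.
move=> ha hb a1 b1.
apply: (@integrableS _ _ _ mu `[-1, 1]) => //.
  by move=> x /=; rewrite !in_itv/=; lra.
have mp : measurable_fun [set: R] (horner p).
  by apply: continuous_measurable_fun; exact: continuous_horner.
apply: (@le_integrable _ _ _ mu `[-1, 1] (measurable_itv _) _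
  (fun x => (\sum_(i < size p) `|p`_i|)%:E
            * (jacobi_weight alpha beta x)%:E)%E).
- apply/measurable_EFinP/measurable_funTS; apply: measurable_funM => //.
  exact: measurable_jacobi_weight.
- move=> x /=; rewrite in_itv/= => xx; rewrite lee_fin !normrM ler_wpM2r//.
  rewrite horner_coef (le_trans (ler_norm_sum _ _ _))// ger0_norm ?sumr_ge0//.
  apply: ler_sum => i _; rewrite normrM ler_piMr// normrX exprn_ile1//.
  by rewrite ler_norml; lra.
- by apply: integrableZl => //; exact: integrable_jacobi_weight.
Qed.

Lemma linear_integral_weight (alpha beta : R) (c : R) (p q : {poly R})
    (a b : R) : -1 < alpha -> -1 < beta -> -1 <= a -> b <= 1 ->
  \int[mu]_(x in `[a, b]) ((c *: p + q).[x] * jacobi_weight alpha beta x) =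
  c * (\int[mu]_(x in `[a, b]) (p.[x] * jacobi_weight alpha beta x))
  + \int[mu]_(x in `[a, b]) (q.[x] * jacobi_weight alpha beta x).
Proof.
move=> ha hb a1 b1.
rewrite (@eq_Rintegral _ _ R mu `[a, b]
  (fun x => (c *: p).[x] * jacobi_weight alpha beta x
            + q.[x] * jacobi_weight alpha beta x)); last first.
  by move=> x _; rewrite hornerD mulrDl.
rewrite RintegralD//; [|exact: integrable_horner_weight..].
congr (_ + _); rewrite -RintegralZl//; last exact: integrable_horner_weight.
by apply: eq_Rintegral => x _; rewrite hornerZ -mulrA.
Qed.

End integrability.

Lemma moment_map_is_linear (R : realType) (alpha beta : R) (N : nat)
    (a b : 'I_N -> R) : -1 < alpha -> -1 < beta ->
  (forall i, -1 <= a i) -> (forall i, b i <= 1) ->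
  linear (moment_map (jacobi_weight alpha beta) a b).
Proof.
move=> ha hb a1 b1 c p q; apply/colP => i; rewrite !mxE.
exact: linear_integral_weight.
Qed.

Lemma data_map_is_linear (R : realType) (alpha beta : R) (N : nat)
    (a b : 'I_N -> R) : -1 < alpha -> -1 < beta ->
  (forall i, -1 <= a i) -> (forall i, b i <= 1) ->
  linear (data_map alpha beta a b).
Proof.
move=> ha hb a1 b1 c p q; rewrite /data_map scale_col_mx add_col_mx.
congr col_mx.
  apply/matrixP => i j; rewrite !ord1 !mxE !mulr1n.
  exact: linear_integral_weight.
apply/colP => i; rewrite !mxE /deriv_functional -!derivE derivD derivZ.
exact: linear_integral_weight.
Qed.

Lemma rising_gt0 {R : realType} (x : R) (n : nat) : 0 < x -> 0 < rising x n.
Proof.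
by move=> x0; apply: prodr_gt0 => i _; rewrite ltr_wpDr.
Qed.

Lemma size_jacobi {R : realType} (alpha beta : R) (n : nat) :
  -1 < alpha -> -1 < beta -> size (jacobi alpha beta n) = n.+1.
Proof.
move=> ha hb; pose y : {poly R} := 2^-1 *: ('X - 1).
have szy l : size (y ^+ l) = l.+1.
  rewrite exprZn size_scale ?expf_neq0 ?invr_eq0 ?pnatr_eq0//.
  by rewrite -polyC1 size_exp_XsubC.
have c_neq0 : rising (n%:R + alpha + beta + 1) n
    * rising (alpha + n%:R + 1) (n - n) / (n`! * (n - n)`!)%:R != 0.
  apply/mulf_neq0.
    apply/mulf_neq0; last by rewrite subnn /rising big_ord0 oner_neq0.
    case: n => [|n]; first by rewrite /rising big_ord0 oner_neq0.
    have n1 : (1 : R) <= n.+1%:R by rewrite ler1n.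
    by rewrite gt_eqF// rising_gt0//; lra.
  by rewrite invr_eq0 pnatr_eq0 -lt0n muln_gt0 !fact_gt0.
rewrite /jacobi big_ord_recr/= addrC size_polyDl size_scale//= szy// ltnS.
apply: (leq_trans (size_sum _ _ _)); apply/bigmax_leqP => l _.
by apply: (leq_trans (size_scale_leq _ _)); rewrite szy.
Qed.

Lemma jacobi_basis_of (R : realType) (alpha beta : R) (N : nat) :
  -1 < alpha -> -1 < beta ->
  basis_of (fullv : {vspace {poly_(1 + N) R}}) (jacobi_basis alpha beta N).
Proof.
move=> ha hb; set X := jacobi_basis alpha beta N.
have X_E (i : 'I_(1 + N)) : (X`_i : {poly R}) = jacobi alpha beta i.
  by rewrite -tnth_nth tnth_mktuple.
rewrite basisEfree subvf size_tuple dim_polyn leqnn !andbT.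
apply/freeP => c /(congr1 (fun p : {poly_(1 + N) R} => (p : {poly R}))).
rewrite linear0 linear_sum/= => c0 i; apply: contrapT => /eqP ci.
have [m cm mmax] := @arg_maxnP _ i (fun j => c j != 0) (fun j => j : nat) ci.
move: c0 => /(congr1 (fun p : {poly R} => p`_m)).
rewrite coef0 coef_sum (bigD1 m)//= big1 => [|j jm].
  rewrite addr0 X_E coefZ => /eqP; rewrite mulf_eq0 (negbTE cm)/=.
  have := size_jacobi m ha hb; rewrite -[X in _ = X -> _]/(m : nat).+1 => sm.
  have -> : (jacobi alpha beta m)`_m = lead_coef (jacobi alpha beta m).
    by rewrite lead_coefE sm.
  by rewrite lead_coef_eq0 -size_poly_eq0 sm.
rewrite X_E coefZ; have [->|cj] := eqVneq (c j) 0; first by rewrite mul0r.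
rewrite nth_default ?mulr0// size_jacobi//.
by have jlem : (j <= m)%N := mmax j cj; rewrite ltn_neqAle jlem andbT.
Qed.

Lemma jacobi0 {R : realType} (alpha beta : R) : jacobi alpha beta 0 = 1.
Proof.
by rewrite /jacobi big_ord1 /rising !big_ord0 mul1r invr1 mulr1 scale1r expr0.
Qed.

Lemma jacobi_at1 {R : realType} (alpha beta : R) (n : nat) :
  (jacobi alpha beta n).[1] = rising (alpha + 1) n / n`!%:R.
Proof.
rewrite /jacobi big_ord_recl/= hornerD horner_sum big1 => [|i _].
  rewrite addr0 expr0 alg_polyC hornerC subn0 fact0 mul1n addr0.
  by rewrite {1}/rising big_ord0 mul1r.
by rewrite hornerZ horner_exp !hornerE subrr mulr0 expr0n mulr0.
Qed.

(* Main.v *)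
(* The Jacobi differential equation puts omega P_n, for n >= 1, in divergence
   form:
     ((1 - x)^(alpha+1) (1 + x)^(beta+1) P_n')'
       = - n (n + alpha + beta + 1) omega P_n.
   The function being differentiated vanishes at -1 and 1, so M(P_n) = 0; since
   moreover P_0' = 0, the matrix is block diagonal. If all the data of p vanish,
   then admissibility applied to p' makes p constant, and M(p) = p h_0 with
   h_0 > 0 forces p = 0; hence the matrix, and with it its lower right block, is
   nonsingular. *)

From HB Require Import structures.
Require Import Defs.
From mathcomp Require Import all_boot all_order all_algebra.
From mathcomp Require Import all_classical all_reals all_analysis.
From mathcomp Require Import ring lra.

Import Order.TTheory GRing.Theory Num.Theory.
Import numFieldNormedType.Exports.

Local Open Scope classical_set_scope.
Local Open Scope ring_scope.

(** * The Jacobi differential equation *)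

Definition jacobi_coef {R : realType} (alpha beta : R) (n l : nat) : R :=
  rising (n%:R + alpha + beta + 1) l
    * rising (alpha + l%:R + 1) (n - l) / (l`! * (n - l)`!)%:R.

(** The hypergeometric form as a polynomial in y = (x - 1) / 2; since the argument of 2F1 is -y, the
    signs of (-n)_l cancel. *)
Definition jacobi_hyp {R : realType} (alpha beta : R) (n : nat) : {poly R} :=
  \poly_(l < n.+1) jacobi_coef alpha beta n l.

Lemma jacobi_comp (R : realType) (alpha beta : R) (n : nat) :
  jacobi alpha beta n = jacobi_hyp alpha beta n \Po (2^-1 *: ('X - 1)).
Proof.
rewrite /jacobi_hyp poly_def raddf_sum/=; apply: eq_bigr => l _.
by rewrite linearZ/= rmorphXn/= comp_polyX.
Qed.

Lemma risingS (R : realType) (x : R) (n : nat) :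
  rising x n.+1 = rising x n * (x + n%:R).
Proof. by rewrite /rising big_ord_recr. Qed.

Lemma risingSl (R : realType) (x : R) (n : nat) :
  rising x n.+1 = x * rising (x + 1) n.
Proof.
rewrite /rising big_ord_recl addr0; congr (_ * _).
by apply: eq_bigr => i _; rewrite lift0 -natr1 addrA addrAC.
Qed.

(** The ratio of consecutive hypergeometric coefficients, cleared of denominators. It persists for
    [l >= n]: at [l = n] the factor n - l vanishes, and beyond that both coefficients do. *)
Lemma jacobi_hyp_rec (R : realType) (alpha beta : R) (n l : nat) :
  l.+1%:R * (l%:R + alpha + 1) * (jacobi_hyp alpha beta n)`_l.+1 =
  (n%:R - l%:R) * (n%:R + l%:R + alpha + beta + 1) * (jacobi_hyp alpha beta n)`_l.
Proof.
rewrite !coef_poly !ltnS.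
have [ln|nl|->] := ltngtP l n; last by rewrite subrr !mul0r mulr0.
- rewrite /jacobi_coef risingS.
  (* This form of [n] removes the truncated subtractions. *)
  have [k ->] : exists k, n = (l + k).+1.
    by exists (n - l.+1)%N; rewrite -addSn subnKC.
  rewrite subSS addKn subSn ?leq_addr// addKn risingSl.
  have fl : (l`!)%:R != 0 :> R by rewrite pnatr_eq0 -lt0n fact_gt0.
  have fk : (k`!)%:R != 0 :> R by rewrite pnatr_eq0 -lt0n fact_gt0.
  have sl : l%:R + 1 != 0 :> R by rewrite natr1 pnatr_eq0.
  have sk : k%:R + 1 != 0 :> R by rewrite natr1 pnatr_eq0.
  have -> : alpha + l.+1%:R + 1 = alpha + l%:R + 1 + 1 by rewrite -natr1; ring.
  rewrite !factS !natrM -!natr1 natrD.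
  by field; rewrite fl fk sl sk.
- by rewrite !mulr0.
Qed.

Lemma hypergeometric_ode (R : realType) (alpha beta : R) (n : nat) :
  let q := jacobi_hyp alpha beta n in
  ('X + 'X^2) * q^`()^`() + ((alpha + 1)%:P + (alpha + beta + 2) *: 'X) * q^`()
  = (n%:R * (n%:R + alpha + beta + 1)) *: q.
Proof.
move=> q; apply/polyP => l.
(* With s = alpha + beta + 1, n(n + s) = (n - k)(n + k + s) + k(k + s), so the recurrence is the
   equation read at degree k. *)
have rec k : (n%:R * (n%:R + alpha + beta + 1)) * q`_k =
    k.+1%:R * (k%:R + alpha + 1) * q`_k.+1 + k%:R * (k%:R + alpha + beta + 1) * q`_k.
  by rewrite jacobi_hyp_rec; ring.
rewrite !mulrDl -scalerAl -mul_polyC !coefD !coefCM coefZ expr2 -mulrA !coefXM rec.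
(* Multiplication by ['X] and ['X^2] shifts indices, so degrees 0 and 1 are separate cases. *)
move: q {rec} => q; case: l => [|[|l]]; rewrite ?coef_deriv/= ?coef_deriv ?coefXM ?coef_deriv /=.
all: by ring.
Qed.

(** For y = (x - 1) / 2, y + y^2 = (x^2 - 1) / 4 and each x-derivative contributes 1/2: the powers
    of 2 cancel and the sign flips. *)
Lemma jacobi_ode_comp (R : realType) (alpha beta lambda : R) (q : {poly R}) (x : R) :
  ('X + 'X^2) * q^`()^`() + ((alpha + 1)%:P + (alpha + beta + 2) *: 'X) * q^`()
  = lambda *: q ->
  let p := q \Po (2^-1 *: ('X - 1)) in
  (1 - x ^+ 2) * p^`()^`().[x] + (beta - alpha - (alpha + beta + 2) * x) * p^`().[x]
  = - lambda * p.[x].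
Proof.
move=> ode p; rewrite /p.
have dy : (2^-1 *: ('X - 1))^`() = (2^-1)%:P :> {poly R}.
  by rewrite derivZ derivB derivX -polyC1 derivC subr0 alg_polyC.
have := congr1 (horner^~ (2^-1 * (x - 1))) ode.
rewrite /= !deriv_comp dy derivM deriv_comp dy derivC mulr0 addr0.
rewrite !(hornerD, hornerM, hornerZ, hornerC, hornerX, hornerN, hornerXn, horner_comp).
by move=> odex; rewrite mulNr -odex; field.
Qed.

Lemma jacobi_ode (R : realType) (alpha beta : R) (n : nat) (x : R) :
  let p := jacobi alpha beta n in
  (1 - x ^+ 2) * p^`()^`().[x] + (beta - alpha - (alpha + beta + 2) * x) * p^`().[x]
  = - (n%:R * (n%:R + alpha + beta + 1)) * p.[x].
Proof. by rewrite /= jacobi_comp; apply/jacobi_ode_comp/hypergeometric_ode. Qed.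

(** * Calculus with singularities at the endpoints *)

Lemma is_derive_parameterized_integral (R : realType) (f : R -> R) (a b x : R) :
  (@lebesgue_measure R).-integrable `[a, b] (EFin \o f) ->
  {in `]a, b[, continuous f} -> x \in `]a, b[ ->
  is_derive x 1 (fun y => parameterized_integral (@lebesgue_measure R) a y f) (f x).
Proof.
move=> intf cf xab; have /andP[ax xb] : a < x < b by move: xab; rewrite in_itv.
have [dF F'] := @continuous_FTC1_closed R f a x b xb intf ax (cf x xab).
by apply: DeriveDef; [exact: dF|rewrite -derive1E; exact: F'].
Qed.

(* Unlike continuous_FTC2, the following two lemmas let f be unbounded at the
   endpoints, as the Jacobi weight is for negative exponents. *)
Lemma Rintegral_mean_value (R : realType) (f : R -> R) (a b : R) : a < b ->
  (@lebesgue_measure R).-integrable `[a, b] (EFin \o f) ->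
  {in `]a, b[, continuous f} ->
  exists2 c, c \in `]a, b[ &
    \int[@lebesgue_measure R]_(x in `[a, b]) f x = f c * (b - a).
Proof.
move=> ab intf cf.
(* The mean value theorem is applied to the indefinite integral, which integrability alone makes
   continuous up to the endpoints. *)
have [x|c cab E] := @MVT R (fun y => parameterized_integral lebesgue_measure a y f) f a b ab _
  (parameterized_integral_continuous (ltW ab) intf).
  exact: is_derive_parameterized_integral.
exists c => //; rewrite -E {2}/parameterized_integral set_itv1 Rintegral_set1.
by rewrite subr0.
Qed.

Lemma integrable_FTC2 (R : realType) (f F : R -> R) (a b : R) : a < b ->
  (@lebesgue_measure R).-integrable `[a, b] (EFin \o f) ->
  {in `]a, b[, continuous f} -> {within `[a, b], continuous F} ->
  (forall x, x \in `]a, b[ -> is_derive x 1 F (f x)) ->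
  \int[@lebesgue_measure R]_(x in `[a, b]) f x = F b - F a.
Proof.
move=> ab intf cf cF dF.
pose I y := parameterized_integral (@lebesgue_measure R) a y f.
have cIF : {within `[a, b], continuous (fun y => I y - F y)}.
  move=> x; apply: cvgB; last exact: cF.
  exact: (parameterized_integral_continuous (ltW ab) intf).
(* [I - F] has derivative 0 inside, hence equal values at [a] and [b]; moreover [I a] is 0. *)
have [x xab|c _] := @MVT R (fun y => I y - F y) (fun=> 0) a b ab _ cIF.
  have dI := is_derive_parameterized_integral R f a b x intf cf xab.
  by have := is_deriveB dI (dF x xab); rewrite subrr.
rewrite mul0r {2}/I /parameterized_integral set_itv1 Rintegral_set1.
by rewrite sub0r opprK addrAC => /eqP; rewrite subr_eq0 => /eqP <-; rewrite addrK.
Qed.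

(* The absolute value is needed: 0 `^ p = 0, but powR sends negative numbers to 1. *)
Lemma continuous_powR_norm (R : realType) (p : R) : 0 < p ->
  continuous (fun x : R => `|x| `^ p).
Proof.
move=> p0 x; have [->|x0] := eqVneq x 0; last first.
  apply: (@continuous_comp _ _ _ (fun x : R => `|x|) (@powR R ^~ p)).
    exact: norm_continuous.
  by apply: continuous_powR_pos; rewrite normr_gt0.
rewrite /continuous_at normr0 powR0 ?gt_eqF//.
apply/cvgrPdist_lt => e e0.
have := powR_cvg0 p0 => /cvgrPdist_lt/(_ _ e0)[d /= d0 dP].
exists d => //= y; rewrite /= sub0r normrN => yd.
(* [powR_cvg0] is a limit from the right at 0 and says nothing at 0 itself. *)
have [->|y0] := eqVneq y 0; first by rewrite normr0 powR0 ?gt_eqF// subrr normr0.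
apply: dP => /=; last by rewrite normr_gt0.
by rewrite sub0r normrN normr_id.
Qed.

(** * Derivative and continuity of the Jacobi weight *)

Lemma powRD1 (R : realType) (x p : R) : 0 < x -> x `^ (p + 1) = x `^ p * x.
Proof. move=> x0; rewrite powRD; last by rewrite (gt_eqF x0) implybT.
by rewrite powRr1 ?ltW.
Qed.

Lemma jacobi_weightS (R : realType) (alpha beta x : R) : x \in `]-1, 1[ ->
  jacobi_weight (alpha + 1) (beta + 1) x =
  (1 - x ^+ 2) * jacobi_weight alpha beta x.
Proof.
rewrite in_itv/= => /andP[x0 x1]; rewrite /jacobi_weight.
have l0 : 0 < 1 - x by lra.
have r0 : 0 < 1 + x by lra.
by rewrite !powRD1//; ring.
Qed.

(** The Pearson equation of the weight omega: the factor of omega is exactly the coefficient of P_n'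
    in [jacobi_ode], which yields the divergence form. *)
Lemma is_derive_jacobi_weightS (R : realType) (alpha beta x : R) : x \in `]-1, 1[ ->
  is_derive x 1 (jacobi_weight (alpha + 1) (beta + 1))
    ((beta - alpha - (alpha + beta + 2) * x) * jacobi_weight alpha beta x).
Proof.
rewrite in_itv/= => /andP[x0 x1].
have l0 : 0 < 1 - x by lra.
have r0 : 0 < 1 + x by lra.
have dl : is_derive x 1 (fun x : R => 1 - x) (-1).
  by rewrite -[X in is_derive _ _ _ X]add0r; apply: is_deriveB.
have dr : is_derive x 1 (fun x : R => 1 + x) 1.
  by rewrite -[X in is_derive _ _ _ X]add0r; apply: is_deriveD.
have dpl := @is_derive1_comp _ (@powR R ^~ (alpha + 1)) (fun x : R => 1 - x) _ _ _
  (is_derive1_powR (alpha + 1) l0) dl.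
have dpr := @is_derive1_comp _ (@powR R ^~ (beta + 1)) (fun x : R => 1 + x) _ _ _
  (is_derive1_powR (beta + 1) r0) dr.
apply: (is_derive_eq (is_deriveM dpl dpr)).
rewrite /jacobi_weight /GRing.scale/= !addrK !powRD1//; ring.
Qed.

(** Meant for the raised exponents alpha + 1 and beta + 1, which are positive even where omega is
    unbounded. *)
Lemma within_continuous_jacobi_weight (R : realType) (alpha beta : R) :
  0 < alpha -> 0 < beta -> {within `[-1, 1], continuous (jacobi_weight alpha beta)}.
Proof.
move=> ha hb.
apply: (@subspace_eq_continuous R `[-1, 1] R
  (fun x : R => `|1 - x| `^ alpha * `|1 + x| `^ beta) (jacobi_weight alpha beta)).
  move=> x; rewrite inE/= in_itv/= => /andP[x0 x1].
  by rewrite /jacobi_weight !ger0_norm//; lra.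
apply: continuous_subspaceT => x; apply: cvgM.
  apply: (@continuous_comp _ _ _ (fun x : R => 1 - x) (fun x => `|x| `^ alpha)).
    by apply: cvgB; [exact: cvg_cst|exact: cvg_id].
  exact: continuous_powR_norm.
apply: (@continuous_comp _ _ _ (fun x : R => 1 + x) (fun x => `|x| `^ beta)).
  by apply: cvgD; [exact: cvg_cst|exact: cvg_id].
exact: continuous_powR_norm.
Qed.

Lemma continuous_jacobi_weight (R : realType) (alpha beta : R) :
  {in `]-1, 1[, continuous (jacobi_weight alpha beta)}.
Proof.
move=> x; rewrite in_itv/= => /andP[x0 x1]; apply: cvgM.
  apply: (@continuous_comp _ _ _ (fun x : R => 1 - x) (@powR R ^~ alpha)).
    by apply: cvgB; [exact: cvg_cst|exact: cvg_id].
  by apply: continuous_powR_pos; lra.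
apply: (@continuous_comp _ _ _ (fun x : R => 1 + x) (@powR R ^~ beta)).
  by apply: cvgD; [exact: cvg_cst|exact: cvg_id].
by apply: continuous_powR_pos; lra.
Qed.

(** * Integrals against the weight *)

Lemma normalization_jacobi (R : realType) (alpha beta : R) (n : nat) :
  -1 < alpha -> -1 < beta -> (0 < n)%N ->
  normalization_functional (jacobi_weight alpha beta) (horner (jacobi alpha beta n)) = 0.
Proof.
move=> ha hb n0; set p := jacobi alpha beta n.
set lambda : R := n%:R * (n%:R + alpha + beta + 1).
(* From n >= 1 and alpha + beta > -2, n + alpha + beta + 1 is positive. *)
have lambda0 : lambda != 0.
  have n1 : 1 <= n%:R :> R by rewrite ler1n.
  by rewrite mulf_neq0 ?gt_eqF//; lra.
(* The primitive of omega P_n supplied by the divergence form. *)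
pose F x := - lambda^-1 * (jacobi_weight (alpha + 1) (beta + 1) x * p^`().[x]).
(* Both boundary values vanish, as [powR] sends base 0 to 0 at the nonzero exponents alpha + 1 and
   beta + 1. *)
transitivity (F 1 - F (-1)); last first.
  by rewrite /F /jacobi_weight !subrr !powR0 ?gt_eqF ?mul0r ?mulr0 ?mul0r
    ?mulr0 ?subrr//; lra.
apply: integrable_FTC2.
- lra.
- exact: integrable_horner_weight.
- move=> x xx; apply: cvgM; first exact: continuous_horner.
  exact: continuous_jacobi_weight.
- move=> x; apply: cvgM; first exact: cvg_cst.
  apply: cvgM; first by apply: within_continuous_jacobi_weight; lra.
  by apply: continuous_subspaceT; exact: continuous_horner.
- move=> x xx.
  have dF := is_deriveZ (- lambda^-1)
    (is_deriveM (is_derive_jacobi_weightS R alpha beta x xx) (is_derive_poly p^`() x)).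
  apply: (is_derive_eq dF); rewrite /GRing.scale/= jacobi_weightS//.
  rewrite (_ : _ + _ = jacobi_weight alpha beta x * ((1 - x ^+ 2) * p^`()^`().[x] +
    (beta - alpha - (alpha + beta + 2) * x) * p^`().[x])); last by ring.
  by rewrite jacobi_ode -/lambda -/p; field.
Qed.

(** The integral is 2 omega(c) for an interior c, where both bases are positive. *)
Lemma Rintegral_jacobi_weight_gt0 (R : realType) (alpha beta : R) :
  -1 < alpha -> -1 < beta ->
  0 < \int[@lebesgue_measure R]_(x in `[-1, 1]) jacobi_weight alpha beta x.
Proof.
move=> ha hb.
have [|||c] := @Rintegral_mean_value R (jacobi_weight alpha beta) (-1) 1.
- lra.
- exact: integrable_jacobi_weight.
- exact: continuous_jacobi_weight.
rewrite in_itv/= => /andP[c0 c1] ->.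
by rewrite /jacobi_weight !mulr_gt0 ?powR_gt0//; lra.
Qed.

(** * Nonsingularity from a trivial kernel *)

Lemma matrix_of_mulmx (R : realType) (V : lmodType R) (m n : nat)
    (X : n.-tuple V) (f : V -> 'cV[R]_m) (c : 'cV[R]_n) : linear f ->
  matrix_of X f *m c = f (\sum_k c k 0 *: tnth X k).
Proof.
move=> lf.
pose fL : {linear V -> 'cV[R]_m} :=
  HB.pack f (GRing.isLinear.Build R V 'cV[R]_m *:%R f lf).
rewrite -[f]/(fL : _ -> _) linear_sum.
apply/colP => i; rewrite mxE summxE; apply: eq_bigr => k _.
by rewrite linearZ !mxE mulrC.
Qed.

Lemma matrix_of_unitmx (R : realType) (V : vectType R) (n : nat)
    (X : n.-tuple V) (f : V -> 'cV[R]_n) : linear f -> free X ->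
  (forall v, f v = 0 -> v = 0) -> matrix_of X f \in unitmx.
Proof.
(* [det0P] yields a row vector in the left kernel, hence the transposition. *)
move=> lf /freeP frX f0; rewrite -unitmx_tr unitmxE unitfE.
apply/negP => /det0P[v v0 vA]; case/eqP: v0.
have : matrix_of X f *m v^T = 0 by rewrite -[LHS]trmxK trmx_mul trmxK vA trmx0.
rewrite matrix_of_mulmx// => /f0 vX; apply/rowP => k; rewrite !mxE.
apply: (frX (fun k => v 0 k)); rewrite -[RHS]vX; apply: eq_bigr => i _.
by rewrite (tnth_nth 0) mxE.
Qed.

Lemma deriv_eq0 (R : realType) (p : {poly R}) : p^`() = 0 -> p = (p`_0)%:P.
Proof.
move=> p0; apply/polyP => -[|k]; rewrite coefC//=.
have /eqP := congr1 (fun q : {poly R} => q`_k) p0.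
by rewrite coef_deriv coef0 mulrn_eq0/= => /eqP.
Qed.

Lemma data_map_inj0 (R : realType) (alpha beta : R) (N : nat) (a b : 'I_N -> R)
    (p : {poly_(1 + N) R}) : -1 < alpha -> -1 < beta ->
  admissible (jacobi_weight alpha beta) a b -> data_map alpha beta a b p = 0 -> p = 0.
Proof.
move=> ha hb /bij_inj inj /eqP; rewrite col_mx_eq0 => /andP[/eqP M0 /eqP D0].
(* Differentiation lowers the size by one, so p' lies in the domain of [moment_map]. *)
have szd : p^`() \is a poly_of_size N.
  have := valP p; rewrite !qualifE/= => szp.
  by rewrite (leq_trans (size_poly _ _))// -subn1 leq_subLR.
have dp0 : (p : {poly R})^`() = 0.
  suff : NPoly szd = 0 by move/(congr1 val).
  (* Injectivity compares p' with 0, so the moments of 0 are computed as well. *)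
  apply: inj; apply/colP => i; have /colP/(_ i) := D0.
  rewrite !mxE /deriv_functional -derivE => ->.
  rewrite (_ : (fun x => _) = cst 0); last by apply/funext => x; rewrite horner0 mul0r.
  by rewrite Rintegral_cst// mul0r.
apply/val_inj => /=; have pE := deriv_eq0 _ _ dp0.
have /matrixP/(_ 0 0) := M0; rewrite !mxE mulr1n /normalization_functional pE.
under eq_Rintegral do rewrite hornerC.
rewrite RintegralZl//; last exact: integrable_jacobi_weight.
move/eqP; rewrite mulf_eq0 [X in _ || X]gt_eqF ?Rintegral_jacobi_weight_gt0// orbF.
by move/eqP => ->; rewrite polyC0.
Qed.

Theorem proposition10 (R : realType) (alpha beta : R) (N : nat)
    (a b : 'I_N -> R)
    (halpha : -1 < alpha) (hbeta : -1 < beta) (hN : (1 <= N)%N)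
    (hs : forall i : 'I_N, [/\ -1 <= a i, a i < b i & b i <= 1])
    (hadm : admissible (jacobi_weight alpha beta) a b) :
  let h0 := normalization_functional (jacobi_weight alpha beta) (fun=> 1) in
  [/\ data_matrix alpha beta a b
        = block_mx h0%:M 0 0 (reduced_deriv_matrix alpha beta a b),
      h0 = \int[@lebesgue_measure R]_(x in `[-1, 1]%classic)
             jacobi_weight alpha beta x,
      data_matrix alpha beta a b \in unitmx
    & reduced_deriv_matrix alpha beta a b \in unitmx].
Proof.
move=> h0.
have one0 : horner (jacobi alpha beta 0) = (fun=> 1).
  by apply/funext => x; rewrite jacobi0 hornerC.
have blockE : data_matrix alpha beta a b
    = block_mx h0%:M 0 0 (reduced_deriv_matrix alpha beta a b).
  (* Column k of the right blocks carries P_{k+1}, of positive index as [normalization_jacobi]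
     requires. *)
  rewrite -[LHS]submxK; congr block_mx; apply/matrixP => i k;
    rewrite !mxE tnth_mktuple ?(unsplitK (inl _)) ?(unsplitK (inr _)) ?mxE ?ord1/=.
  - by rewrite one0.
  - by rewrite normalization_jacobi.
  - rewrite /deriv_functional -derivE jacobi0 -polyC1 derivC.
    under eq_Rintegral do rewrite horner0 mul0r.
    by rewrite Rintegral_cst// mul0r.
  - by [].
have unitH : data_matrix alpha beta a b \in unitmx.
  apply: matrix_of_unitmx.
  - by apply: data_map_is_linear => // i; have [] := hs i.
  - exact: basis_free (jacobi_basis_of N halpha hbeta).
  - by move=> p; exact: data_map_inj0.
split=> //.
- by apply: eq_Rintegral => x _; rewrite mul1r.
(* The determinant of the block matrix is the product of those of its diagonal blocks, so both are
   units. *)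
- by move: unitH; rewrite blockE !unitmxE det_ublock unitrM => /andP[].
Qed.
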